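(* There is a constant $C>0$ such that the following holds. Let $(\varepsilon_n)_{n\ge 1}$ be a real sequence with $\varepsilon_n\to 0$ as $n\to\infty$ and $|\varepsilon_n|<1/9$ for all $n$. Then there is an $n_0$ such that for all $n\ge n_0$ for which $M:=(1+\varepsilon_n)n/2\in\mathbb{N}$, and for all real $A\ge 1$, writing $\varepsilon=\varepsilon_n$: (i) if $\varepsilon<-e\,n^{-1/2}$, then $\mathbb{P}\big(T_{n,M}>A C|\varepsilon|^{-1}\ln(\varepsilon^2 n)\big)\le e^{-A}$; (ii) if $|\varepsilon|\le e\,n^{-1/2}$, then $\mathbb{P}\big(T_{n,M}>A C n^{1/2}\big)\le e^{-A}$; (iii) if $\varepsilon>e\,n^{-1/2}$, then $\mathbb{P}\big(T_{n,M}>A\varepsilon^{-1}e^{C\varepsilon^2 n}\big)\le e^{-A}$.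
   Context: Here $e$ is Euler's number, $\mathbb{N}=\{1,2,\dots\}$ and $\mathbb{N}_0=\mathbb{N}\cup\{0\}$. Dispersion process on the complete graph with $n$ vertices and $M\ge 2$ particles: the vertices are $\{1,\dots,n\}$ and the particles are $p_1,\dots,p_M$; $p_{i,t}$ denotes the position of $p_i$ at time $t\in\mathbb{N}_0$. At time $0$ all particles are at vertex $1$ ($p_{i,0}=1$ for all $i$) and all are unhappy: $\mathcal{U}_0=\{p_1,\dots,p_M\}$, $\mathcal{H}_0=\emptyset$. Let $(G_{i,t})_{1\le i\le M,\,t\in\mathbb{N}_0}$ be independent and uniform on $\{1,\dots,n\}$. For $t\in\mathbb{N}_0$ set $p_{i,t+1}=p_{i,t}$ if $p_i\in\mathcal{H}_t$ and $p_{i,t+1}=G_{i,t+1}$ if $p_i\in\mathcal{U}_t$, and set $\mathcal{H}_{t+1}=\{p_i: p_{i,t+1}\ne p_{j,t+1}\text{ for all }j\ne i\}$ (happy particles) and $\mathcal{U}_{t+1}=\{p_1,\dots,p_M\}\setminus\mathcal{H}_{t+1}$ (unhappy particles). Let $U_t=|\mathcal{U}_t|$. The dispersion time is $T_{n,M}=\inf\{t\in\mathbb{N}_0: U_t=0\}$. *)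

(* Defs.v *)
From mathcomp Require Export all_boot all_order all_algebra.
From mathcomp Require Export all_classical all_reals all_analysis.
Export Order.TTheory GRing.Theory Num.Theory.
Export numFieldNormedType.Exports.

#[export] Set Implicit Arguments.
#[export] Unset Strict Implicit.
#[export] Unset Printing Implicit Defensive.

Local Open Scope classical_set_scope.
Local Open Scope ring_scope.

(* The values lie in 'I_n with its discrete sigma-algebra, so the events of a
   variable X k are the preimages of arbitrary subsets of 'I_n. Independence is
   that of the whole family: the product rule over every finite duplicate-free
   list of indices. *)
Definition independent_family (R : realType) (d : measure_display)
    (Omega : measurableType d) (P : probability Omega R)
    (I : eqType) (n : nat) (X : I -> Omega -> 'I_n) : Prop :=
  forall (s : seq I) (B : I -> set 'I_n), uniq s ->
    P (\bigcap_(k in [set` s]) (X k @^-1` B k))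
    = (\prod_(k <- s) P (X k @^-1` B k))%E.

Definition uniform_variable (R : realType) (d : measure_display)
    (Omega : measurableType d) (P : probability Omega R)
    (n : nat) (Y : Omega -> 'I_n) : Prop :=
  forall v : 'I_n, P (Y @^-1` [set v]) = (n%:R^-1)%:E.

Definition iid_uniform (R : realType) (d : measure_display)
    (Omega : measurableType d) (P : probability Omega R)
    (M n : nat) (G : 'I_M -> nat -> Omega -> 'I_n) : Prop :=
  [/\ forall i t (B : set 'I_n), measurable (G i t @^-1` B),
      forall i t, uniform_variable P (G i t)
    & independent_family P (fun k : 'I_M * nat => G k.1 k.2)].

Definition happy (n M : nat) (p : 'I_M -> 'I_n) : {set 'I_M} :=
  [set i | [forall j, (j != i) ==> (p i != p j)]]%SET.

(* The process is a deterministic function of the array g of proposed moves;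
   a state is the pair (positions, set of happy particles). At time 0 no
   particle is happy, whatever the positions (this matters only for M = 1). *)
Fixpoint dispersion (n M : nat) (v1 : 'I_n) (g : 'I_M -> nat -> 'I_n) (t : nat)
    : ('I_M -> 'I_n) * {set 'I_M} :=
  match t with
  | 0%N => (fun=> v1, finset.set0)
  | t'.+1 =>
      let: (p, H) := dispersion v1 g t' in
      let p' := fun i => if i \in H then p i else g i t'.+1 in
      (p', happy p')
  end.

Definition unhappy_count (n M : nat) (v1 : 'I_n) (g : 'I_M -> nat -> 'I_n)
    (t : nat) : nat :=
  #|(~: (dispersion v1 g t).2)%SET|.

(* Extended-real valued: +oo if some particle is unhappy at every time. *)
Definition dispersion_time (R : realType) (n M : nat) (v1 : 'I_n)
    (g : 'I_M -> nat -> 'I_n) : \bar R :=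
  ereal_inf [set (t%:R)%:E | t in [set t : nat | unhappy_count v1 g t = 0%N]].

(* The probability that T_{n,M} > x. The vertices 1, ..., n are 0, ..., n - 1
   in 'I_n, so the starting vertex 1 is the ordinal 0. *)
Definition dispersion_tail (R : realType) (d : measure_display)
    (Omega : measurableType d) (P : probability Omega R)
    (n M : nat) (n_gt0 : (0 < n)%N) (G : 'I_M -> nat -> Omega -> 'I_n)
    (x : R) : \bar R :=
  P [set w | (x%:E < dispersion_time R (Ordinal n_gt0) (fun i t => G i t w))%E].

(* Main.v *)
Require Import Defs.
From mathcomp Require Import zify ring lra.

Local Open Scope classical_set_scope.
Local Open Scope ring_scope.

(** Put m = M / n = (1 + eps) / 2 and let u be the current number of unhappy
particles. Two one-step estimates, without error terms and valid in every reachable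
state, carry the proof.

- Drift ([expect_unhappy]). The next number of unhappy particles is at most the
  number of ordered pairs of particles that share a vertex. A pair in which at
  least one particle moves meets with probability 1 / n, and counting these
  pairs bounds the mean by 2 m u - u^2 / n = (1 + eps) u - u^2 / n.

- Fluctuations ([expect_expr_unhappy]). Place the moving particles one after the
  other. Each of them hits an occupied vertex with probability at most m, and
  then creates at most two unhappy particles. Hence the next number of unhappy
  particles is dominated by the offspring of u independent individuals who each
  have two children with probability m and none otherwise, which in terms of
  generating functions says E z^U' >= (1 - m + m z^2)^u for 0 <= z <= 1.

Both estimates iterate along the same recursion y_0 = m,
y_{t+1} = y_t (1 + eps - y_t) ([logistic]): by concavity of the drift the mean
number of unhappy particles at time t is at most n y_t, and the dominating
branching process started from one individual is extinct at time t with
probability 1 - y_t / m. Running the first bound for t steps and the second for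
t further steps, and using Jensen's inequality, one finds that from every
reachable state the process has stopped after 2 t steps with probability at
least exp (- (2 / m) n y_t^2) as soon as y_t <= m / 2
([ler_expect_extinct2]). As this is uniform in the state, k successive attempts
fail with probability at most (1 - q)^k, which gives the exponential tail in A
([dispersion_tail_le]).

It remains to choose t. Always y_t <= max (eps, 0) + 1 / (t + 2), and for
eps < 0 moreover y_{t+s} <= y_t e^{eps s}. In the critical window t of order
sqrt n makes n y_t^2 bounded; for eps > 0, t of order 1 / eps makes it of order
eps^2 n, which is the exponent in the supercritical bound; for eps < 0, another
ln (eps^2 n) / |eps| steps make it at most 1. *)

(** * One step of the process *)

Definition state (n M : nat) := (('I_M -> 'I_n) * {set 'I_M})%type.

Definition move (n M : nat) (s : state n M) (x : 'I_M -> 'I_n) : 'I_M -> 'I_n :=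
  fun i => if i \in s.2 then s.1 i else x i.

Definition step (n M : nat) (s : state n M) (x : 'I_M -> 'I_n) : state n M :=
  (move s x, happy (move s x)).

Definition unhappy (n M : nat) (s : state n M) : nat := #|(~: s.2)%SET|.

(** The invariant under which the one-step estimates hold. It is weaker than
[s.2 = happy s.1], so that it also covers the initial state, where all particles
sit at one vertex and none counts as happy. *)
Definition separated (n M : nat) (s : state n M) : Prop :=
  {in s.2 &, injective s.1}.

Lemma separated_step (n M : nat) (s : state n M) (x : 'I_M -> 'I_n) :
  separated (step s x).
Proof.
move=> i j; rewrite inE => /forallP /(_ j) /implyP hi _ /= eq_ij.
by case: (eqVneq j i) => [//|/hi]; rewrite eq_ij eqxx.
Qed.

Lemma unhappy_step_absorbed (n M : nat) (s : state n M) (x : 'I_M -> 'I_n) :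
  separated s -> unhappy s = 0%N -> unhappy (step s x) = 0%N.
Proof.
move=> inj_s /eqP; rewrite /unhappy cards_eq0 => /eqP s0.
have sT i : i \in s.2 by move/setP/(_ i): s0; rewrite !inE => /negbFE.
apply/eqP; rewrite cards_eq0; apply/eqP/setP => i; rewrite !inE.
apply/negbTE; rewrite negbK; apply/forallP => j; apply/implyP.
by apply: contraNN; rewrite /move !sT => /eqP/inj_s ->.
Qed.

(** * Averaging over the proposed moves *)

Definition avg (R : realType) (n M : nat) (F : {ffun 'I_M -> 'I_n} -> R) : R :=
  (n%:R ^+ M)^-1 * \sum_x F x.

Lemma eq_avg (R : realType) (n M : nat) (F F' : {ffun 'I_M -> 'I_n} -> R) :
  F =1 F' -> avg F = avg F'.
Proof. by move=> eqF; rewrite /avg; congr (_ * _); apply: eq_bigr. Qed.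

Lemma ler_avg (R : realType) (n M : nat) (F F' : {ffun 'I_M -> 'I_n} -> R) :
  (forall x, F x <= F' x) -> avg F <= avg F'.
Proof.
move=> leF; apply: ler_wpM2l; first by rewrite invr_ge0 exprn_ge0.
exact: ler_sum.
Qed.

Lemma avg_cst (R : realType) (n M : nat) (c : R) : (0 < n)%N ->
  avg (fun _ : {ffun 'I_M -> 'I_n} => c) = c.
Proof.
move=> n_gt0; rewrite /avg sumr_const card_ffun !card_ord -(mulr_natl c) mulrA natrX.
by rewrite mulVf ?mul1r// expf_neq0// pnatr_eq0 -lt0n.
Qed.

Lemma avgM (R : realType) (n M : nat) (c : R) (F : {ffun 'I_M -> 'I_n} -> R) :
  avg (fun x => c * F x) = c * avg F.
Proof. by rewrite /avg -mulr_sumr mulrCA. Qed.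

Lemma avgD (R : realType) (n M : nat) (F F' : {ffun 'I_M -> 'I_n} -> R) :
  avg (fun x => F x + F' x) = avg F + avg F'.
Proof. by rewrite /avg big_split mulrDr. Qed.

Lemma avg_sum (R : realType) (n M : nat) (I : finType) (Q : pred I)
    (F : I -> {ffun 'I_M -> 'I_n} -> R) :
  avg (fun x => \sum_(k | Q k) F k x) = \sum_(k | Q k) avg (F k).
Proof. by rewrite /avg exchange_big mulr_sumr. Qed.

Definition overwrite (n M : nat) (x : {ffun 'I_M -> 'I_n}) (i : 'I_M) (v : 'I_n) :
  {ffun 'I_M -> 'I_n} := [ffun j => if j == i then v else x j].

(** Exchanging the coordinate [i] of [x] with an independent uniform [v] is an
involution of the pairs [(x, v)], so it preserves the uniform measure. This is
what lets one particle at a time be placed. *)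
Lemma avg_resample (R : realType) (n M : nat) (i : 'I_M)
    (F : {ffun 'I_M -> 'I_n} -> R) : (0 < n)%N ->
  avg F = avg (fun x => n%:R^-1 * \sum_v F (overwrite x i v)).
Proof.
move=> n_gt0; rewrite avgM /avg mulrCA; congr (_ * _).
rewrite pair_bigA /=.
pose phi (u : {ffun 'I_M -> 'I_n} * 'I_n) := (overwrite u.1 i u.2, u.1 i).
have phiK : involutive phi.
  move=> [x v]; rewrite /phi /=; congr (_, _); last by rewrite ffunE eqxx.
  by apply/ffunP => j; rewrite !ffunE; case: eqP => [->|].
rewrite (reindex_inj (inv_inj phiK)) /=.
rewrite (eq_bigr (fun u => F u.1)); last first.
  by move=> u _; rewrite -[in RHS](phiK u).
rewrite -(pair_bigA _ (fun x _ => F x)) /=.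
rewrite [X in _ * X](eq_bigr (fun x => n%:R * F x)).
  by rewrite -mulr_sumr mulKf// pnatr_eq0 -lt0n.
by move=> x _; rewrite sumr_const card_ord mulr_natl.
Qed.

(** * Drift: counting meeting pairs *)

Definition expect (R : realType) (n M : nat) (f : state n M -> R)
    (s : state n M) : R := avg (fun x => f (step s x)).

Lemma unhappy_stepE (n M : nat) (s : state n M) (x : 'I_M -> 'I_n) :
  unhappy (step s x) =
  #|[set i | [exists j, (j != i) && (move s x i == move s x j)]]%SET|.
Proof.
rewrite /unhappy; apply: eq_card => i; rewrite !inE negb_forall.
by apply: eq_existsb => j; rewrite negb_imply negbK.
Qed.

Lemma avg_meet (R : realType) (n M : nat) (s : state n M) (i j : 'I_M) :
  (0 < n)%N -> j != i -> i \notin s.2 ->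
  avg (fun x => (move s x i == move s x j)%:R) = n%:R^-1 :> R.
Proof.
move=> n_gt0 ji si; rewrite (avg_resample i)//.
rewrite (eq_avg (F' := fun=> n%:R^-1)) ?avg_cst// => x.
rewrite -[RHS]mulr1; congr (_ * _).
rewrite (bigD1 (move s x j)) //= big1 ?addr0.
  by rewrite /move (negbTE si) !ffunE eqxx (negbTE ji) eqxx.
move=> v; rewrite /move (negbTE si) !ffunE eqxx (negbTE ji).
by case: ifP => _ /negbTE ->.
Qed.

(** The pairs that can meet are the off-diagonal ones outside [H * H], where [H]
is the set of happy particles: M^2 - (M - u)^2 pairs lie outside [H * H], and u
of them are diagonal. *)
Lemma card_meeting_pairs (n M : nat) (s : state n M) :
  (#|[set k : 'I_M * 'I_M | (k.2 != k.1) && ~~ ((k.1 \in s.2) && (k.2 \in s.2))]%SET|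
   + unhappy s * unhappy s + unhappy s = 2 * M * unhappy s)%N.
Proof.
pose B := (~: finset.setX s.2 s.2)%SET; pose D := [set (i, i) | i in (~: s.2)%SET]%SET.
have hu : (#|s.2| + unhappy s = M)%N by rewrite cardsC card_ord.
have cardB : (#|s.2| * #|s.2| + #|B| = M * M)%N.
  by rewrite -cardsX cardsC card_prod !card_ord.
have cardD : #|(B :&: D)%SET| = unhappy s.
  have /finset.setIidPr -> : D \subset B.
    by apply/fintype.subsetP => k /imsetP[i]; rewrite inE => si ->; rewrite !inE negb_and si.
  by rewrite card_imset// => i j [].
have := cardsID D B; rewrite cardD => BE.
have BDE : (B :\: D)%SET =
    [set k | (k.2 != k.1) && ~~ ((k.1 \in s.2) && (k.2 \in s.2))]%SET.
  apply/setP => -[i j]; rewrite !inE /=.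
  have -> : ((i, j) \in D) = (j == i) && (i \notin s.2).
    apply/imsetP/andP => [[k + [-> ->]]|[/eqP -> si]]; first by rewrite inE eqxx.
    by exists i; rewrite ?inE.
  by case: eqVneq => [->|]; case: (i \in s.2); case: (j \in s.2).
have arith h u p m : (h + u = m -> h * h + (u + p) = m * m -> p + u * u + u = 2 * m * u)%N.
  by move=> <-; nia.
by apply: (arith #|s.2|) => //; rewrite -BDE BE.
Qed.

(** Every unhappy particle has a partner at its vertex, so the unhappy particles
are at most as many as the ordered meeting pairs; two happy particles that do
not move never meet. *)
Lemma expect_unhappy (R : realType) (n M : nat) (s : state n M) :
  (0 < n)%N -> separated s ->
  expect (fun s' => (unhappy s')%:R : R) s
    <= 2 * (M%:R / n%:R) * (unhappy s)%:R - (unhappy s)%:R ^+ 2 / n%:R.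
Proof.
move=> n_gt0 inj_s.
pose Q (k : 'I_M * 'I_M) := (k.2 != k.1) && ~~ ((k.1 \in s.2) && (k.2 \in s.2)).
have n0 : n%:R != 0 :> R by rewrite pnatr_eq0 -lt0n.
apply: (@le_trans _ _ (\sum_(k | Q k) n%:R^-1)); last first.
  rewrite sumr_const -[X in X <= _]mulr_natl.
  have /(congr1 (fun k => k%:R : R)) := card_meeting_pairs s.
  rewrite cardsE !natrD !natrM => pairsE.
  have -> : #|Q|%:R = 2 * M%:R * (unhappy s)%:R - (unhappy s)%:R ^+ 2 - (unhappy s)%:R :> R.
    by rewrite -pairsE; ring.
  rewrite -subr_ge0 (_ : _ - _ = (unhappy s)%:R / n%:R) ?divr_ge0//.
  by field.
apply: (@le_trans _ _ (avg (fun x => \sum_(k | Q k) (move s x k.1 == move s x k.2)%:R))).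
  apply: ler_avg => x; rewrite unhappy_stepE -natr_sum ler_nat.
  set A := [set i | _]%SET.
  apply: (@leq_trans (\sum_(i in A) \sum_(j | Q (i, j)) (move s x i == move s x j))).
    rewrite -sum1_card; apply: leq_sum => i; rewrite inE => /existsP[j /andP[ji /eqP mij]].
    rewrite (bigD1 j) /= ?mij ?eqxx//; rewrite /Q /= ji /=; apply/negP => /andP[si sj].
    move: mij; rewrite /move si sj => /(inj_s _ _ si sj) ij.
    by rewrite ij eqxx in ji.
  rewrite -(pair_big_dep xpredT (fun i j => Q (i, j))
     (fun i j => (move s x i == move s x j) : nat)) /=.
  rewrite [leqRHS](bigID (mem A)) /= leq_addr//.
rewrite avg_sum ler_sum// => -[i j] /=; rewrite /Q negb_and /= => /andP[ji /orP[si|sj]].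
  by rewrite avg_meet.
rewrite -(avg_meet R (i := j) (j := i) n_gt0 _ sj) 1?eq_sym//.
by apply: ler_avg => x; rewrite eq_sym.
Qed.

(** * Fluctuations: comparison with a binary branching process *)

(** The particles of [D] that would be unhappy if [D] were the set of all
particles. Growing [D] from the happy particles to everything models the
successive placement of the moving particles. *)
Definition colliding (n M : nat) (s : state n M) (D : {set 'I_M}) (x : 'I_M -> 'I_n) :
    {set 'I_M} :=
  [set i in D | [exists j in D, (j != i) && (move s x i == move s x j)]]%SET.

(** A newcomer at a vertex occupied by the others adds at most itself and one
particle that was alone there: if two were there, they collided already. *)
Lemma colliding_overwrite (n M : nat) (s : state n M) (D : {set 'I_M}) (i : 'I_M)
    (x : {ffun 'I_M -> 'I_n}) (v : 'I_n) :
  i \in D -> i \notin s.2 ->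
  (#|colliding s D (overwrite x i v)| <=
   #|colliding s (D :\ i)%SET x| + 2 * (v \in [set move s x j | j in (D :\ i)%SET]%SET))%N.
Proof.
move=> iD si; set A := colliding s D _; set A0 := colliding s _ x.
have mi : move s (overwrite x i v) i = v by rewrite /move (negbTE si) ffunE eqxx.
have mj j : j != i -> move s (overwrite x i v) j = move s x j.
  by move=> /negbTE ji; rewrite /move ffunE ji.
have old j l : j \in D -> l \in D -> j != i -> l != i -> l != j ->
    move s x j = move s x l -> j \in A0.
  move=> jD lD ji li lj jl; rewrite !inE ji jD /=; apply/existsP; exists l.
  by rewrite !inE li lD lj jl eqxx.
case: imsetP => [[j0 j0D vE]|Nv].
  apply: (@leq_trans #|(i |: (j0 |: A0))%SET|); last first.
    by rewrite !cardsU1 addnA addnC leq_add2l; case: (i \notin _); case: (j0 \notin _).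
  apply: subset_leq_card; apply/fintype.subsetP => j; rewrite !in_setU1.
  rewrite inE => /andP[jD /existsP[l /and3P[lD lj /eqP mjl]]].
  have [//|ji] := eqVneq j i; have [//|jj0] := eqVneq j j0; rewrite !orFb.
  have /setD1P[j0i {}j0D] := j0D.
  have [li|li] := eqVneq l i; last by apply: (old j l) => //; rewrite -!mj.
  apply: (old j j0) => //; first by rewrite eq_sym.
  by rewrite -vE -mj// mjl li mi.
rewrite muln0 addn0; apply: subset_leq_card; apply/fintype.subsetP => j.
rewrite inE => /andP[jD /existsP[l /and3P[lD lj /eqP mjl]]].
have [ji|ji] := eqVneq j i.
  rewrite ji in lj mjl; case: Nv; exists l; first by rewrite !inE lj.
  by rewrite -mj// -mjl mi.
have [li|li] := eqVneq l i; last by apply: (old j l) => //; rewrite -!mj.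
by case: Nv; exists j; rewrite ?inE ?ji// -mj// mjl li mi.
Qed.

(** By induction on the number of placed particles: given the others, the last
one hits one of at most [M] occupied vertices, and otherwise changes nothing. *)
Lemma avg_expr_colliding (R : realType) (n M : nat) (s : state n M) (z : R)
    (D : {set 'I_M}) :
  (0 < n)%N -> (M <= n)%N -> separated s -> 0 <= z <= 1 -> s.2 \subset D ->
  (1 - M%:R / n%:R + M%:R / n%:R * z ^+ 2) ^+ #|(D :\: s.2)%SET|
    <= avg (fun x : {ffun 'I_M -> 'I_n} => z ^+ #|colliding s D x|).
Proof.
move=> n_gt0 leMn inj_s /andP[z0 z1].
have n0 : n%:R != 0 :> R by rewrite pnatr_eq0 -lt0n.
have z21 : z ^+ 2 <= 1 by rewrite expr_le1.
set f := 1 - _ + _.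
have fE : f = n%:R^-1 * (n%:R - (1 - z ^+ 2) * M%:R) by rewrite /f; field.
have f0 : 0 <= f.
  rewrite fE mulr_ge0// subr_ge0; apply: (@le_trans _ _ M%:R); last by rewrite ler_nat.
  by rewrite ler_piMl// gerBl sqr_ge0.
(* Remove from [D] one moving particle [i], which is resampled last. *)
move: {2}#|_| (erefl #|(D :\: s.2)%SET|) => k; elim: k D => [|k IH] D.
  move=> /eqP; rewrite cards_eq0 finset.setD_eq0 => DH HD.
  have {DH HD} -> : D = s.2 by apply/eqP; rewrite finset.eqEsubset DH.
  rewrite finset.setDv cards0 expr0 (eq_avg (F' := fun=> 1)) ?avg_cst// => x.
  rewrite (_ : colliding _ _ _ = finset.set0) ?cards0//.
  apply/setP => i; rewrite !inE; apply/negbTE/negP => /andP[si /existsP[j /and3P[sj ji]]].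
  by rewrite /move si sj => /eqP /(inj_s _ _ si sj) ij; rewrite ij eqxx in ji.
move=> cardD HD.
have /card_gt0P[i] : (0 < #|(D :\: s.2)%SET|)%N by rewrite cardD.
rewrite inE => /andP[si iD].
have cardD0 : #|(D :\ i :\: s.2)%SET| = k.
  move: cardD; rewrite (cardsD1 i) !inE si iD /= => -[<-].
  by apply: eq_card => j; rewrite !inE; case: (_ \in s.2); case: (j == i).
have HD0 : s.2 \subset (D :\ i)%SET by rewrite subsetD1 HD.
rewrite cardD exprS (avg_resample i)//.
apply: le_trans (ler_wpM2l f0 (_ : _ <= avg (fun x => z ^+ #|colliding s (D :\ i)%SET x|))) _.
  by rewrite -cardD0; apply: IH.
rewrite -avgM; apply: ler_avg => x.
set w := #|colliding s _ x|; set I := [set move s x j | j in (D :\ i)%SET]%SET.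
have leI : (#|I| <= M)%N.
  by apply: leq_trans (leq_imset_card _ _) _; rewrite -[leqRHS]card_ord max_card.
rewrite fE -mulrA ler_wpM2l ?invr_ge0//.
apply: (@le_trans _ _ (\sum_v (z ^+ w - (1 - z ^+ 2) * z ^+ w * (v \in I)%:R))).
  rewrite sumrB sumr_const card_ord -mulr_sumr.
  have -> : \sum_v (v \in I)%:R = #|I|%:R :> R.
    by rewrite -sum1_card natr_sum [RHS]big_mkcond /=; apply: eq_bigr => v _; case: ifP.
  rewrite mulrBl -(mulr_natl (z ^+ w)) lerB// [leRHS]mulrAC ler_wpM2l ?ler_nat//.
  by rewrite mulr_ge0 ?subr_ge0 ?exprn_ge0.
apply: ler_sum => v _.
apply: le_trans (ler_wiXn2l z0 z1 (colliding_overwrite x v iD si)).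
rewrite -/I -/w exprD exprM mulrC.
by case: (v \in I) => /=; rewrite ?mulr1 ?mulr0 ?expr1 ?expr0; lra.
Qed.

Lemma expect_expr_unhappy (R : realType) (n M : nat) (s : state n M) (z : R) :
  (0 < n)%N -> (M <= n)%N -> separated s -> 0 <= z <= 1 ->
  (1 - M%:R / n%:R + M%:R / n%:R * z ^+ 2) ^+ unhappy s
    <= expect (fun s' => z ^+ unhappy s') s.
Proof.
move=> n_gt0 leMn inj_s z01.
have := avg_expr_colliding n_gt0 leMn inj_s z01 (finset.subsetT s.2).
rewrite finset.setTD => /le_trans; apply; rewrite le_eqVlt; apply/orP; left; apply/eqP.
apply: eq_avg => x; congr (_ ^+ _); rewrite unhappy_stepE; apply: eq_card => i.
by rewrite !inE; apply: eq_existsb => j; rewrite inE.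
Qed.

(** * Iterating the two estimates *)

Lemma ler_iter_expect (R : realType) (n M : nat) (f g : state n M -> R) :
  (forall s, separated s -> f s <= g s) ->
  forall t s, separated s -> iter t (@expect R n M) f s <= iter t (@expect R n M) g s.
Proof.
move=> le_fg; elim=> [//|t IH] s sep_s /=.
by apply: ler_avg => x; apply: IH; apply: separated_step.
Qed.

Lemma iter_expect_affine (R : realType) (n M : nat) (f : state n M -> R) (a b : R)
    (t : nat) (s : state n M) : (0 < n)%N ->
  iter t (@expect R n M) (fun s' => a * f s' + b) s = a * iter t (@expect R n M) f s + b.
Proof.
move=> n_gt0; elim: t s => [//|t IH] s /=.
by rewrite /expect (eq_avg (fun x => IH (step s x))) avgD avgM avg_cst.
Qed.

(** With m = (1 + eps) / 2 this is the recursion y (1 + eps - y). It describes at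
once the mean density of unhappy particles and, divided by [m], the survival
probability of the branching process. *)
Definition logistic (R : realType) (m : R) (t : nat) : R :=
  iter t (fun y => y * (2 * m - y)) m.

Lemma logistic_itv (R : realType) (m : R) (t : nat) :
  0 <= m <= 1 -> 0 <= logistic m t <= m.
Proof.
move=> m01; elim: t => [|t] /=; first by lra.
by rewrite /logistic /=; set y := iter _ _ _; nra.
Qed.

(** The drift u |-> 2 m u - u^2 / n is concave, so it may be replaced by its
tangent at the mean [a] of the state at time [t]; averages of affine functions
are explicit. *)
Lemma expect_iter_unhappy (R : realType) (n M t : nat) (s : state n M) :
  (0 < n)%N -> (M <= n)%N -> separated s ->
  iter t (@expect R n M) (fun s' => (unhappy s')%:R) s
    <= n%:R * logistic (M%:R / n%:R) t.
Proof.
move=> n_gt0 leMn sep_s.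
have nR : 0 < n%:R :> R by rewrite ltr0n.
have n0 : n%:R != 0 :> R by rewrite gt_eqF.
set m := M%:R / n%:R.
have m01 : 0 <= m <= 1 by rewrite /m divr_ge0//= ler_pdivrMr// mul1r ler_nat.
elim: t => [|t IH] /=.
  rewrite /logistic /= /m mulrC divfK// ler_nat /unhappy.
  by rewrite -[leqRHS]card_ord max_card.
rewrite -/(iter t.+1 _ _) iterSr.
set a := iter t _ _ _ in IH.
have tangent : forall s', separated s' ->
    expect (fun s0 : state n M => (unhappy s0)%:R) s'
      <= (2 * m - 2 * a / n%:R) * (unhappy s')%:R + a ^+ 2 / n%:R.
  move=> s' sep'; apply: le_trans (expect_unhappy _ n_gt0 sep') _; rewrite -/m.
  rewrite -subr_ge0 (_ : _ - _ = ((unhappy s')%:R - a) ^+ 2 / n%:R); last by field.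
  by rewrite divr_ge0// sqr_ge0.
apply: le_trans (ler_iter_expect tangent t sep_s) _.
rewrite iter_expect_affine// -/a.
have /andP[y0 ym] := logistic_itv t m01.
rewrite /logistic /= -/(logistic m t); set y := logistic m t in IH y0 ym *.
have by_ : a / n%:R <= y by rewrite ler_pdivrMr// mulrC.
(* The map y |-> y (2 m - y) is increasing on [0, m]. *)
rewrite -subr_ge0 (_ : _ - _ = n%:R * ((y - a / n%:R) * (2 * m - y - a / n%:R))); last by field.
by apply: mulr_ge0 => //; apply: mulr_ge0; lra.
Qed.

(** Here [1 - logistic m t / m] is the t-th iterate at 0 of the generating
function z |-> 1 - m + m z^2. The indicator of extinction is 0^u, the case
t = 0. *)
Lemma ler_expect_extinct (R : realType) (n M t : nat) (s : state n M) :
  (0 < n)%N -> (0 < M <= n)%N -> separated s ->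
  (1 - logistic (M%:R / n%:R) t / (M%:R / n%:R)) ^+ unhappy s
    <= iter t (@expect R n M) (fun s' => (unhappy s' == 0%N)%:R) s.
Proof.
move=> n_gt0 /andP[M_gt0 leMn].
have nR : 0 < n%:R :> R by rewrite ltr0n.
set m := M%:R / n%:R.
have mp : 0 < m by rewrite divr_gt0// ltr0n.
have m01 : 0 <= m <= 1 by rewrite ltW//= ler_pdivrMr// mul1r ler_nat.
elim: t s => [|t IH] s sep_s /=.
  by rewrite /logistic /= (divff (lt0r_neq0 mp)) subrr expr0n.
have /andP[y0 ym] := logistic_itv t m01.
rewrite /logistic /= -/(logistic m t); set y := logistic m t in IH y0 ym *.
have -> : 1 - y * (2 * m - y) / m = 1 - m + m * (1 - y / m) ^+ 2.
  by field; rewrite gt_eqF.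
have z01 : 0 <= 1 - y / m <= 1.
  by rewrite subr_ge0 ler_pdivrMr// mul1r ym gerBl divr_ge0// ltW.
apply: le_trans (expect_expr_unhappy n_gt0 leMn sep_s z01) _.
by apply: ler_avg => x; apply: IH; apply: separated_step.
Qed.

Lemma expR_ge_1B (R : realType) (x : R) : 0 <= x <= 1 / 2 -> expR (- (2 * x)) <= 1 - x.
Proof.
move=> x01; rewrite expRN; apply: (@le_trans _ _ (1 + 2 * x)^-1).
  by rewrite lef_pV2 ?expR_ge1Dx// posrE ?expR_gt0//; lra.
have p : 0 < 1 + 2 * x by lra.
by rewrite invf_ple ?posrE//; [rewrite -[leLHS]mul1r ler_pdivrMr; nra|nra].
Qed.

(** After [t] steps the mean of u is at most n y_t, and then [t] more steps
extinguish the process with probability at least (1 - y_t / m)^u >= e^{-cu} with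
c = 2 y_t / m. Jensen's inequality for this exponential is again a tangent line
at the mean. *)
Lemma ler_expect_extinct2 (R : realType) (n M t : nat) (s : state n M) :
  let m := M%:R / n%:R : R in
  (0 < n)%N -> (0 < M <= n)%N -> separated s -> logistic m t <= m / 2 ->
  expR (- (2 / m * (n%:R * logistic m t ^+ 2)))
    <= iter (t + t) (@expect R n M) (fun s' => (unhappy s' == 0%N)%:R) s.
Proof.
move=> m n_gt0 /[dup] M_itv /andP[M_gt0 leMn] sep_s.
have nR : 0 < n%:R :> R by rewrite ltr0n.
have mp : 0 < m by rewrite divr_gt0// ltr0n.
have m01 : 0 <= m <= 1 by rewrite ltW//= ler_pdivrMr// mul1r ler_nat.
have /andP[y0 _] := logistic_itv t m01.
set y := logistic m t in y0 * => ym.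
rewrite iterD; pose a : R := iter t (@expect R n M) (fun s' => (unhappy s')%:R) s.
pose c := 2 * (y / m).
have c0 : 0 <= c by rewrite /c !mulr_ge0// invr_ge0 ltW.
have le_a : a <= n%:R * y by exact: expect_iter_unhappy.
have tangent s' : separated s' ->
    (- (expR (- (c * a)) * c)) * (unhappy s')%:R + expR (- (c * a)) * (1 + c * a)
    <= iter t (@expect R n M) (fun s' => (unhappy s' == 0%N)%:R) s'.
  move=> sep'; apply: le_trans (ler_expect_extinct R t n_gt0 M_itv sep').
  rewrite -/m -/y; apply: (@le_trans _ _ (expR (- c) ^+ unhappy s')).
    rewrite -expRM_natl.
    have -> : (unhappy s')%:R * - c = - (c * a) + (c * a - c * (unhappy s')%:R) by ring.
    rewrite expRD; apply: le_trans (ler_wpM2l (expR_ge0 _) (expR_ge1Dx _)).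
    by rewrite le_eqVlt; apply/orP; left; apply/eqP; ring.
  have ym2 : 0 <= y / m <= 1 / 2.
    by rewrite divr_ge0 ?(ltW mp)//= ler_pdivrMr//; lra.
  by rewrite lerXn2r ?nnegrE ?expR_ge0//; [lra|exact: expR_ge_1B].
apply: le_trans (ler_iter_expect tangent t sep_s).
rewrite iter_expect_affine// -/a.
rewrite (_ : _ + _ = expR (- (c * a))); last by ring.
rewrite ler_expR lerN2 (_ : 2 / m * _ = c * (n%:R * y)).
  by rewrite ler_wpM2l.
by rewrite /c; field; rewrite gt_eqF.
Qed.

(** * Restarting *)

Lemma iter_expect_unhappy_absorbed (R : realType) (n M t : nat) (s : state n M) :
  (0 < n)%N -> separated s ->
  iter t (@expect R n M) (fun s' => (unhappy s' != 0%N)%:R) s <= (unhappy s != 0%N)%:R.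
Proof.
move=> n_gt0; elim: t s => [//|t IH] s sep_s /=.
rewrite -[leRHS](avg_cst M _ n_gt0).
apply: ler_avg => x; apply: (le_trans (IH (step s x) (@separated_step n M s x))).
rewrite ler_nat; have [/(unhappy_step_absorbed x sep_s) ->//|_] := eqVneq (unhappy s) 0%N.
exact: leq_b1.
Qed.

Lemma iter_expect_restart (R : realType) (n M tau k N : nat) (q : R) (s : state n M) :
  (0 < n)%N -> q <= 1 ->
  (forall s', separated s' ->
    q <= iter tau (@expect R n M) (fun s' => (unhappy s' == 0%N)%:R) s') ->
  (k * tau <= N)%N -> separated s ->
  iter N (@expect R n M) (fun s' => (unhappy s' != 0%N)%:R) s <= (1 - q) ^+ k.
Proof.
move=> n_gt0 q1 qP leN sep_s.
have fail_tau s' : separated s' ->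
    iter tau (@expect R n M) (fun s' => (unhappy s' != 0%N)%:R) s'
      <= (1 - q) * (unhappy s' != 0%N)%:R + 0.
  move=> sep'; have [u0|u0] := eqVneq (unhappy s') 0%N.
    apply: le_trans (iter_expect_unhappy_absorbed R tau n_gt0 sep') _.
    by rewrite u0 eqxx mulr0 addr0.
  rewrite (_ : (fun _ => _) = (fun s' : state n M => -1 * (unhappy s' == 0%N)%:R + 1)).
    by rewrite iter_expect_affine// mulr1; have := qP _ sep'; lra.
  by apply/funext => s0; case: (_ == _) => /=; ring.
rewrite -(subnKC leN) iterD.
have absorbed s' := @iter_expect_unhappy_absorbed R n M (N - k * tau) s' n_gt0.
apply: (le_trans (ler_iter_expect absorbed _ sep_s)).
elim: k {leN absorbed} => [|k IH].
  by rewrite mul0n expr0 /=; case: (unhappy s).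
rewrite mulSn addnC iterD; apply: (le_trans (ler_iter_expect fail_tau _ sep_s)).
by rewrite iter_expect_affine// addr0 exprS ler_wpM2l// subr_ge0.
Qed.

(** With q = e^{-5 B} a lower bound for the success of one attempt of length 2 t,
about A / q attempts are enough, since (1 - q)^k <= e^{-kq}. The factor 5
dominates 2 / m; rounding A / q up costs a factor at most 2, whence the 4. *)
Lemma iter_expect_tail (R : realType) (n M t : nat) (A B x : R) (s : state n M) :
  let m := M%:R / n%:R : R in
  (0 < n)%N -> (M <= n)%N -> 4 / 9 <= m -> separated s ->
  logistic m t <= m / 2 -> n%:R * logistic m t ^+ 2 <= B -> 1 <= A ->
  A * (4 * t%:R * expR (5 * B)) <= x ->
  iter (Num.truncn x) (@expect R n M) (fun s' => (unhappy s' != 0%N)%:R) s <= expR (- A).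
Proof.
move=> m n_gt0 leMn m49 sep_s ym yB A1 lex.
have nR : 0 < n%:R :> R by rewrite ltr0n.
have M_itv : (0 < M <= n)%N.
  rewrite leMn andbT lt0n; apply/negP => /eqP M0.
  by move: m49; rewrite /m M0 mul0r; lra.
have B0 : 0 <= B by apply: le_trans yB; rewrite mulr_ge0// ?sqr_ge0// ltW.
pose q := expR (- (5 * B)).
have q0 : 0 < q by exact: expR_gt0.
have q1 : q <= 1 by rewrite -expR0 ler_expR; lra.
have qP s' : separated s' ->
    q <= iter (t + t) (@expect R n M) (fun s' => (unhappy s' == 0%N)%:R) s'.
  move=> sep'; apply: le_trans (ler_expect_extinct2 n_gt0 M_itv sep' ym).
  rewrite ler_expR lerN2; apply: ler_pM => //.
  - by rewrite mulr_ge0// ?sqr_ge0// ltW.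
  - by rewrite ler_pdivrMr -/m; lra.
pose k := (Num.truncn (A / q)).+1.
have Aq1 : 1 <= A / q by rewrite ler_pdivlMr// mul1r; lra.
have Aqk : A / q <= k%:R by apply: ltW; exact: truncnS_gt.
have kAq : k%:R <= 2 * (A / q).
  rewrite /k -[_.+1%:R]natr1; have : (Num.truncn (A / q))%:R <= A / q by rewrite truncn_le; lra.
  by lra.
have qV : expR (5 * B) = q^-1 by rewrite /q expRN invrK.
have t0 : 0 <= t%:R :> R by [].
have x0 : 0 <= x by apply: le_trans lex; rewrite !mulr_ge0 ?expR_ge0//; lra.
have leN : (k * (t + t) <= Num.truncn x)%N.
  rewrite truncn_ge_nat//; apply: le_trans lex; rewrite qV natrM natrD.
  apply: (@le_trans _ _ (2 * (A / q) * (t%:R + t%:R))); first by rewrite ler_wpM2r; lra.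
  by rewrite le_eqVlt; apply/orP; left; apply/eqP; ring.
apply: le_trans (iter_expect_restart n_gt0 q1 qP leN sep_s) _.
apply: (@le_trans _ _ (expR (- q) ^+ k)).
  by rewrite lerXn2r ?nnegrE ?expR_ge0 ?subr_ge0// expR_ge1Dx.
rewrite -expRM_natl ler_expR mulrN lerN2.
by rewrite -ler_pdivrMr.
Qed.

(** * Bounds on the logistic recursion *)

Lemma harmonic_step (R : realType) (t : nat) (z : R) :
  0 <= z <= (t.+2%:R)^-1 -> z * (1 - z) <= (t.+3%:R)^-1.
Proof.
move=> /andP[z0 zr].
have w2 : 2 <= t.+2%:R :> R by rewrite ler_nat.
have -> : t.+3%:R = t.+2%:R + 1 :> R by rewrite natr1.
set w := t.+2%:R in zr w2 *.
have zw : z * w <= 1 by rewrite -ler_pdivlMr ?mul1r//; lra.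
by rewrite -[leRHS]mul1r ler_pdivlMr; nra.
Qed.

(** For eps = 2 m - 1 <= 0 the recursion is dominated by z |-> z (1 - z). For
eps > 0, the excess z = y - eps over the fixed point obeys
z' = z (1 - eps - z), to which the same domination applies. *)
Lemma logistic_le (R : realType) (m : R) (t : nat) : 0 <= m <= 1 ->
  logistic m t <= Num.max (2 * m - 1) 0 + (t.+2%:R)^-1.
Proof.
move=> m01; have [e0|e0] : 2 * m - 1 <= 0 \/ 0 <= 2 * m - 1 by apply/orP; exact: le_total.
  rewrite (max_r e0) add0r; elim: t => [|t IH]; first by rewrite /logistic /=; lra.
  have /andP[y0 ym] := logistic_itv t m01.
  have := @harmonic_step _ t (logistic m t); rewrite y0 IH => /(_ isT) step_le.
  apply: le_trans step_le; rewrite /logistic /= -/(logistic m t).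
  by rewrite ler_wpM2l//; lra.
rewrite (max_l e0); suff [z0 zr] : 0 <= logistic m t - (2 * m - 1) /\
    logistic m t - (2 * m - 1) <= (t.+2%:R)^-1.
  by rewrite addrC -lerBlDr.
elim: t => [|t [z0 zr]].
  by rewrite /logistic /=; lra.
have := logistic_itv t m01; have := @harmonic_step _ t (logistic m t - (2 * m - 1)).
rewrite z0 zr => /(_ isT).
rewrite /logistic /= -/(logistic m t); set y := logistic m t in z0 zr *.
move=> step_le y_itv.
have -> : y * (2 * m - y) - (2 * m - 1) = (y - (2 * m - 1)) * (1 - y) by ring.
split; first by apply: mulr_ge0 => //; lra.
by apply: le_trans step_le; rewrite ler_wpM2l//; lra.
Qed.

Lemma logistic_decay (R : realType) (m : R) (t s : nat) : 0 <= m <= 1 ->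
  logistic m (t + s) <= logistic m t * expR (s%:R * (2 * m - 1)).
Proof.
move=> m01; elim: s => [|s IH]; first by rewrite addn0 mul0r expR0 mulr1.
rewrite addnS -natr1 mulrDl mul1r expRD mulrA.
have /andP[y0 ym] := logistic_itv (t + s) m01.
have -> : logistic m (t + s).+1 = logistic m (t + s) * (2 * m - logistic m (t + s)) by [].
apply: ler_pM => //; first by lra.
apply: le_trans (expR_ge1Dx (2 * m - 1)).
by lra.
Qed.

(** * From the array of uniform moves to iterated averages *)

Lemma dispersionS (n M : nat) (v1 : 'I_n) (g : 'I_M -> nat -> 'I_n) (t : nat) :
  dispersion v1 g t.+1 = step (dispersion v1 g t) (g^~ t.+1).
Proof. by rewrite /=; case: dispersion. Qed.

Lemma separated_dispersion (n M : nat) (v1 : 'I_n) (g : 'I_M -> nat -> 'I_n) (t : nat) :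
  separated (dispersion v1 g t).
Proof.
case: t => [|t]; first by move=> i j; rewrite inE.
rewrite dispersionS; exact: separated_step.
Qed.

Lemma unhappy_count_absorbed (n M : nat) (v1 : 'I_n) (g : 'I_M -> nat -> 'I_n)
    (t t' : nat) : (t <= t')%N ->
  unhappy_count v1 g t = 0%N -> unhappy_count v1 g t' = 0%N.
Proof.
move=> /subnKC <-; elim: (t' - t)%N => [|k IH] t0; first by rewrite addn0.
rewrite addnS /unhappy_count dispersionS.
by apply: unhappy_step_absorbed; [exact: separated_dispersion|exact: IH].
Qed.

(** A process without unhappy particles is frozen, so the tail event of the
dispersion time is an event about a single time. *)
Lemma lt_dispersion_time (R : realType) (n M : nat) (v1 : 'I_n)
    (g : 'I_M -> nat -> 'I_n) (x : R) : 0 <= x ->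
  (x%:E < dispersion_time R v1 g)%E = (unhappy_count v1 g (Num.truncn x) != 0%N).
Proof.
move=> x0; apply/idP/idP => [|uN].
  apply: contraTN => /eqP u0; rewrite -leNgt.
  apply: (@le_trans _ _ ((Num.truncn x)%:R)%:E).
    by apply: ereal_inf_lbound; exists (Num.truncn x).
  by rewrite lee_fin truncn_le.
apply: (@lt_le_trans _ _ ((Num.truncn x).+1%:R)%:E).
  by rewrite lte_fin truncnS_gt.
apply/ereal_infP => _ [t /= ut <-]; rewrite lee_fin ler_nat ltnNge.
by apply: contraNN uN => /unhappy_count_absorbed/(_ ut)/eqP.
Qed.

Definition run (n M : nat) (v1 : 'I_n) (l : seq {ffun 'I_M -> 'I_n}) : state n M :=
  foldl (fun s (x : {ffun 'I_M -> 'I_n}) => step s x) (fun=> v1, finset.set0) l.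

(** The moves at time 0 are never used, so entry [k] of [l] prescribes the row of
moves at time [k.+1]; the default of [nth] is never reached. *)
Definition cylinder (Omega : Type) (n M : nat) (G : 'I_M -> nat -> Omega -> 'I_n)
    (v1 : 'I_n) (l : seq {ffun 'I_M -> 'I_n}) : set Omega :=
  [set w | forall i k, (k < size l)%N -> G i k.+1 w = nth [ffun=> v1] l k i].

Lemma cylinder_rcons (Omega : Type) (n M : nat) (G : 'I_M -> nat -> Omega -> 'I_n)
    (v1 : 'I_n) (l : seq {ffun 'I_M -> 'I_n}) (x : {ffun 'I_M -> 'I_n}) (w : Omega) :
  cylinder G v1 (rcons l x) w <->
  cylinder G v1 l w /\ [ffun i => G i (size l).+1 w] = x.
Proof.
rewrite /cylinder /= size_rcons; split=> [Gw|[Gw <-] i k].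
  split=> [i k ltk|]; first by rewrite (Gw i k) ?leqW// nth_rcons ltk.
  by apply/ffunP => i; rewrite ffunE (Gw i (size l))// nth_rcons ltnn eqxx.
rewrite ltnS leq_eqVlt nth_rcons => /orP[/eqP ->|ltk].
  by rewrite ltnn eqxx ffunE.
by rewrite ltk; exact: Gw.
Qed.

Lemma dispersion_cylinder (Omega : Type) (n M : nat) (G : 'I_M -> nat -> Omega -> 'I_n)
    (v1 : 'I_n) (l : seq {ffun 'I_M -> 'I_n}) (w : Omega) :
  cylinder G v1 l w -> dispersion v1 (fun i t => G i t w) (size l) = run v1 l.
Proof.
elim/last_ind: l => [//|l x IH] /cylinder_rcons[/IH {}IH xE].
rewrite size_rcons dispersionS IH /run foldl_rcons -/(run _ _); congr step.
by apply/funext => i; rewrite -xE ffunE.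
Qed.

Lemma cylinderE (Omega : Type) (n M : nat) (G : 'I_M -> nat -> Omega -> 'I_n)
    (v1 : 'I_n) (l : seq {ffun 'I_M -> 'I_n}) :
  cylinder G v1 l =
  \bigcap_(k in [set` [seq (i, t) | i <- enum 'I_M, t <- iota 1 (size l)]])
    (G k.1 k.2 @^-1` [set nth [ffun=> v1] l k.2.-1 k.1]).
Proof.
apply/seteqP; split=> [w Gw [i t] /= /allpairsP[[i' t'] /= [_ + [-> ->]]]|w Gw i k ltk].
  by rewrite mem_iota add1n ltnS; case: t' => // t' /Gw.
apply: (Gw (i, k.+1)); apply/allpairsP; exists (i, k.+1).
by rewrite mem_enum mem_iota add1n ltnS; split.
Qed.

Lemma measurable_cylinder (R : realType) (d : measure_display)
    (Omega : measurableType d) (P : probability Omega R)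
    (n M : nat) (G : 'I_M -> nat -> Omega -> 'I_n)
    (v1 : 'I_n) (l : seq {ffun 'I_M -> 'I_n}) :
  iid_uniform P G -> measurable (cylinder G v1 l).
Proof.
move=> [mG _ _]; rewrite cylinderE; apply: fin_bigcap_measurable => //.
Qed.

Lemma prob_cylinder (R : realType) (d : measure_display)
    (Omega : measurableType d) (P : probability Omega R)
    (n M : nat) (G : 'I_M -> nat -> Omega -> 'I_n)
    (v1 : 'I_n) (l : seq {ffun 'I_M -> 'I_n}) :
  iid_uniform P G -> P (cylinder G v1 l) = ((n%:R ^+ M)^-1 ^+ size l)%:E.
Proof.
move=> [_ unifG indepG]; rewrite cylinderE.
rewrite (indepG _ (fun k => [set nth [ffun=> v1] l k.2.-1 k.1])); last first.
  by apply: allpairs_uniq; rewrite ?enum_uniq ?iota_uniq// => -[i t] [i' t'] _ _.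
under eq_bigr do rewrite unifG.
rewrite prodEFin big_const_seq count_predT size_allpairs size_iota -cardE card_ord.
by rewrite iter_mulr mulr1 -exprVn exprM.
Qed.

(** Given the first [size l] rows of proposed moves, the rest of the evolution is
governed by the iterated average. The induction on the number [N] of remaining
steps splits the event according to the value of the next row; the theorem uses
it for the empty history. *)
Lemma prob_dispersion_cylinder (R : realType) (d : measure_display)
    (Omega : measurableType d) (P : probability Omega R)
    (n M : nat) (G : 'I_M -> nat -> Omega -> 'I_n)
    (v1 : 'I_n) (F : pred (state n M)) (N : nat) (l : seq {ffun 'I_M -> 'I_n}) :
  iid_uniform P G ->
  let E := cylinder G v1 l `&`
    [set w | F (dispersion v1 (fun i t => G i t w) (size l + N))] in
  measurable E /\
  P E = ((n%:R ^+ M)^-1 ^+ size l *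
         iter N (@expect R n M) (fun s => (F s)%:R) (run v1 l))%:E.
Proof.
move=> iidG; elim: N l => [|N IH] l /=.
  rewrite addn0; case: (boolP (F (run v1 l))) => Fl.
    rewrite (_ : _ `&` _ = cylinder G v1 l).
      by rewrite mulr1; split; [exact: measurable_cylinder iidG|exact: prob_cylinder].
    by apply/seteqP; split=> [w []//|w Gw]; split=> //=; rewrite dispersion_cylinder.
  rewrite (_ : _ `&` _ = set0); first by rewrite mulr0 measure0.
  by apply/seteqP; split=> [w [Gw /=]|//]; rewrite dispersion_cylinder// (negbTE Fl).
set E := _ `&` _.
pose E' x := cylinder G v1 (rcons l x) `&`
    [set w | F (dispersion v1 (fun i t => G i t w) (size (rcons l x) + N))].
have EE : E = \bigcup_(x in [set` enum {ffun 'I_M -> 'I_n}]) E' x.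
  apply/seteqP; split=> [w [Gw Fw]|w [x _ [/cylinder_rcons[Gw xE]]]].
    exists [ffun i => G i (size l).+1 w]; first by rewrite /= mem_enum.
    by split; [apply/cylinder_rcons|rewrite /= size_rcons addSnnS].
  by rewrite /= size_rcons addSnnS.
have finT := finite_seq (enum {ffun 'I_M -> 'I_n}).
have mE' x := (IH (rcons l x)).1.
rewrite EE; split; first by apply: fin_bigcup_measurable => // x _; exact: mE'.
have trivE' : trivIset [set` enum {ffun 'I_M -> 'I_n}] E'.
  move=> x y _ _ [w [[/cylinder_rcons[_ xE] _] [/cylinder_rcons[_ yE] _]]].
  by rewrite -xE -yE.
rewrite measure_fin_bigcup//; last by move=> x _; exact: mE'.
rewrite -fsbig_seq ?enum_uniq//.
rewrite (eq_bigr _ (fun x _ => (IH (rcons l x)).2)).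
rewrite sumEFin; congr (_%:E); rewrite big_enum /= /expect /avg mulr_sumr mulr_sumr.
apply: eq_bigr => x _.
by rewrite size_rcons exprSr -mulrA /run foldl_rcons.
Qed.

Lemma dispersion_tailE (R : realType) (d : measure_display)
    (Omega : measurableType d) (P : probability Omega R)
    (n M : nat) (n_gt0 : (0 < n)%N) (G : 'I_M -> nat -> Omega -> 'I_n) (x : R) :
  iid_uniform P G -> 0 <= x ->
  dispersion_tail P n_gt0 G x =
  (iter (Num.truncn x) (@expect R n M) (fun s => (unhappy s != 0%N)%:R)
    (fun=> Ordinal n_gt0, finset.set0))%:E.
Proof.
move=> iidG x0; rewrite /dispersion_tail.
have [_] := prob_dispersion_cylinder (Ordinal n_gt0)
  (fun s => unhappy s != 0%N) (Num.truncn x) [::] iidG.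
rewrite expr0 mul1r add0n => <-; congr (P _); apply/seteqP; split=> w /=.
  by rewrite lt_dispersion_time//.
by rewrite lt_dispersion_time// => -[].
Qed.

(** * The three regimes *)

(** The single estimate behind all three regimes: it only remains to choose [t]
with y_t small. The bound 2 / 9 is half the lower bound 4 / 9 on [m]. *)
Lemma dispersion_tail_le (R : realType) (d : measure_display)
    (Omega : measurableType d) (P : probability Omega R)
    (n M t : nat) (n_gt0 : (0 < n)%N) (G : 'I_M -> nat -> Omega -> 'I_n)
    (m A B x : R) :
  iid_uniform P G -> M%:R = m * n%:R -> 4 / 9 <= m <= 1 ->
  logistic m t <= 2 / 9 -> n%:R * logistic m t ^+ 2 <= B -> 1 <= A ->
  A * (4 * t%:R * expR (5 * B)) <= x ->
  (dispersion_tail P n_gt0 G x <= (expR (- A))%:E)%E.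
Proof.
move=> iidG ME /andP[m49 m1] y29 yB A1 lex.
have nR : 0 < n%:R :> R by rewrite ltr0n.
have mE : M%:R / n%:R = m by rewrite ME mulfK// gt_eqF.
have leMn : (M <= n)%N by rewrite -(ler_nat R) ME ler_piMl// ltW.
rewrite dispersion_tailE//; last first.
  by apply: le_trans lex; rewrite !mulr_ge0 ?expR_ge0//; lra.
rewrite lee_fin; apply: (iter_expect_tail n_gt0 leMn _ _ _ _ A1 lex); rewrite ?mE//.
  by move=> i j; rewrite inE.
by lra.
Qed.

Lemma nat_between (R : realType) (r : R) : 1 <= r ->
  exists t : nat, r <= t%:R <= 2 * r.
Proof.
move=> r1; exists (Num.truncn r).+1; rewrite (ltW (truncnS_gt r)) /=.
have : (Num.truncn r)%:R <= r by rewrite truncn_le; lra.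
by rewrite -[_.+1%:R]natr1; lra.
Qed.

Lemma expR1_le3 (R : realType) : expR 1 <= 3 :> R.
Proof.
have -> : expR 1 = expR (1 / 6) ^+ 6 :> R by rewrite -expRM_natl; congr expR; field.
have e65 : expR (1 / 6) <= 6 / 5 :> R.
  rewrite -[1 / 6]opprK expRN invf_ple ?posrE ?expR_gt0//.
  by apply: le_trans (expR_ge1Dx _); lra.
apply: (@le_trans _ _ ((6 / 5) ^+ 6)); first by rewrite lerXn2r ?nnegrE ?expR_ge0.
by rewrite !exprS expr0; lra.
Qed.

(** After about 1 / |eps| steps y is at most |eps|; another ln (eps^2 n) / |eps|
steps divide it by eps^2 n, so that n y^2 <= 1 / (eps^2 n) <= 1. *)
Lemma subcritical_tail (R : realType) (d : measure_display)
    (Omega : measurableType d) (P : probability Omega R)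
    (n M : nat) (n_gt0 : (0 < n)%N) (G : 'I_M -> nat -> Omega -> 'I_n) (e A : R) :
  iid_uniform P G -> M%:R = (1 + e) * n%:R / 2 -> `|e| < 1 / 9 -> 1 <= A ->
  e < - (expR 1 / Num.sqrt n%:R) ->
  (dispersion_tail P n_gt0 G (A * expR 100 * `|e|^-1 * ln (e ^+ 2 * n%:R))
    <= (expR (- A))%:E)%E.
Proof.
move=> iidG ME e19 A1 elt.
have nR : 0 < n%:R :> R by rewrite ltr0n.
have sn : 0 < Num.sqrt n%:R :> R by rewrite sqrtr_gt0.
have e0 : e < 0 by apply: lt_trans elt _; rewrite oppr_lt0 divr_gt0 ?expR_gt0.
rewrite ltr0_norm// in e19 *.
set a := - e in e19 *; have eE : e = - a by rewrite opprK.
have a0 : 0 < a by rewrite oppr_gt0.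
have asn : expR 1 < a * Num.sqrt n%:R by rewrite -ltr_pdivrMr// ltrNr.
rewrite eE sqrrN; set w := a ^+ 2 * n%:R.
have w2 : expR 2 <= w.
  have -> : expR 2 = expR 1 ^+ 2 :> R by rewrite -expRM_natl mulr1.
  have -> : w = (a * Num.sqrt n%:R) ^+ 2 by rewrite exprMn sqr_sqrtr// ltW.
  by rewrite lerXn2r ?nnegrE ?expR_ge0// ltW// mulr_gt0.
have w0 : 0 < w by apply: lt_le_trans w2; exact: expR_gt0.
have L2 : 2 <= ln w by rewrite -ler_expR lnK.
have w1 : 1 <= w by have := expR_ge1Dx (2 : R); lra.
have ai1 : 9 <= a^-1 by rewrite -[leRHS]mul1r ler_pdivlMr//; lra.
have [|t1 /andP[t1l t1u]] := @nat_between R a^-1; first by lra.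
have [|s /andP[sl su]] := @nat_between R (ln w / a); first by rewrite ler_pdivlMr//; lra.
pose m := (1 - a) / 2.
have m01 : 0 <= m <= 1 by rewrite /m; lra.
have ty : logistic m t1 <= a.
  apply: le_trans (logistic_le t1 m01) _.
  rewrite max_r ?add0r; last by rewrite /m; lra.
  rewrite -[a]invrK lef_pV2 ?posrE ?invr_gt0 ?ltr0n//.
  by apply: le_trans t1l _; rewrite ler_nat -addn2 leq_addr.
have /andP[y10 _] := logistic_itv t1 m01.
have /andP[y0 _] := logistic_itv (t1 + s) m01.
have decay : logistic m (t1 + s) <= a * w^-1.
  apply: le_trans (logistic_decay t1 s m01) _.
  apply: ler_pM; rewrite ?expR_ge0//.
  rewrite -[w]lnK ?posrE// -expRN ler_expR.
  have -> : 2 * m - 1 = - a by rewrite /m; field.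
  by rewrite mulrN lerN2 -ler_pdivrMr.
have wi1 : w^-1 <= 1 by rewrite invf_le1.
have wi0 : 0 < w^-1 by rewrite invr_gt0.
apply: (@dispersion_tail_le _ _ _ _ _ _ (t1 + s) _ _ m A 1) => //.
- by rewrite ME /m eE; field.
- by rewrite /m; lra.
- apply: le_trans decay _; apply: (@le_trans _ _ a); last by lra.
  by rewrite ger_pMr.
- apply: (@le_trans _ _ (n%:R * (a * w^-1) ^+ 2)).
    by rewrite ler_wpM2l ?(ltW nR)// lerXn2r ?nnegrE// ?mulr_ge0// ltW.
  rewrite (_ : _ * _ = w^-1)//.
  by rewrite /w; field; rewrite !gt_eqF.
rewrite mulr1 -!mulrA ler_wpM2l//; first by lra.
have C12 : 12 * expR 5 <= expR 100 :> R.
  have -> : expR 100 = expR 95 * expR 5 :> R by rewrite -expRD; congr expR; ring.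
  by rewrite ler_wpM2r ?expR_ge0//; have := expR_ge1Dx (95 : R); lra.
have tle : (t1 + s)%:R <= 3 * (a^-1 * ln w) :> R.
  have : 0 <= a^-1 * (ln w - 2) by apply: mulr_ge0; lra.
  by rewrite natrD; lra.
apply: (@le_trans _ _ (12 * expR 5 * (a^-1 * ln w))).
  rewrite mulrA [12 * _ * _]mulrAC ler_wpM2r ?expR_ge0//.
  by lra.
by rewrite ler_wpM2r// mulr_ge0; lra.
Qed.

(** After t >= sqrt n steps, y <= |eps| + 1 / t <= (e + 1) / sqrt n
<= 4 / sqrt n, so n y^2 <= 16. *)
Lemma critical_tail (R : realType) (d : measure_display)
    (Omega : measurableType d) (P : probability Omega R)
    (n M : nat) (n_gt0 : (0 < n)%N) (G : 'I_M -> nat -> Omega -> 'I_n) (e A : R) :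
  iid_uniform P G -> M%:R = (1 + e) * n%:R / 2 -> `|e| < 1 / 9 -> 1 <= A ->
  (100 <= n)%N -> `|e| <= expR 1 / Num.sqrt n%:R ->
  (dispersion_tail P n_gt0 G (A * expR 100 * Num.sqrt n%:R) <= (expR (- A))%:E)%E.
Proof.
move=> iidG ME e19 A1 n100 elt.
have nR : 0 < n%:R :> R by rewrite ltr0n.
have sn : 0 < Num.sqrt n%:R :> R by rewrite sqrtr_gt0.
have sn2 : Num.sqrt n%:R ^+ 2 = n%:R :> R by rewrite sqr_sqrtr// ltW.
have sn10 : 10 <= Num.sqrt n%:R :> R.
  rewrite -(@ler_pXn2r _ 2) ?nnegrE ?(ltW sn)// sn2 -natrX ler_nat; exact: n100.
have [|t /andP[tl tu]] := @nat_between R (Num.sqrt n%:R); first by lra.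
pose m := (1 + e) / 2.
have [el eu] : - (1/9) < e /\ e < 1 / 9 by move: e19; rewrite ltr_norml => /andP[]; lra.
have m01 : 0 <= m <= 1 by rewrite /m; lra.
set r := Num.sqrt n%:R in sn sn2 sn10 tl tu elt *.
have ty : logistic m t <= `|e| + r^-1.
  apply: le_trans (logistic_le t m01) _; apply: lerD.
    rewrite (_ : 2 * m - 1 = e); last by rewrite /m; field.
    by rewrite ge_max ler_norm normr_ge0.
  rewrite lef_pV2 ?posrE ?ltr0n//.
  by apply: le_trans tl _; rewrite ler_nat -addn2 leq_addr.
have /andP[y0 _] := logistic_itv t m01.
have ri : r^-1 <= 1 / 10 by rewrite -[leLHS]mul1r ler_pdivrMr//; lra.
have e3 := expR1_le3 R.
have ty4 : logistic m t <= 4 * r^-1.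
  apply: le_trans ty _; rewrite (_ : 4 * r^-1 = 3 / r + r^-1); last by ring.
  by rewrite lerD2r; apply: le_trans elt _; rewrite ler_wpM2r// invr_ge0 ltW.
apply: (@dispersion_tail_le _ _ _ _ _ _ t _ _ m A 16) => //.
- by rewrite ME /m; field.
- by rewrite /m; lra.
- by lra.
- apply: (@le_trans _ _ (n%:R * (4 * r^-1) ^+ 2)).
    by rewrite ler_wpM2l ?(ltW nR)// lerXn2r ?nnegrE// ?mulr_ge0// invr_ge0 ltW.
  by rewrite -sn2 le_eqVlt; apply/orP; left; apply/eqP; field; rewrite gt_eqF.
rewrite -!mulrA ler_wpM2l//; first by lra.
have C8 : 8 * expR (5 * 16) <= expR 100 :> R.
  have -> : expR 100 = expR 20 * expR (5 * 16) :> R by rewrite -expRD; congr expR; ring.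
  by rewrite ler_wpM2r ?expR_ge0//; have := expR_ge1Dx (20 : R); lra.
apply: (@le_trans _ _ (8 * expR (5 * 16) * r)); last by rewrite ler_wpM2r// ltW.
rewrite mulrA [8 * _ * _]mulrAC ler_wpM2r ?expR_ge0//.
by lra.
Qed.

(** After t >= 1 / eps steps, y <= 2 eps, so n y^2 <= 4 eps^2 n. The constant
factors are absorbed in the exponential because eps^2 n >= e^2 is bounded away
from 0. *)
Lemma supercritical_tail (R : realType) (d : measure_display)
    (Omega : measurableType d) (P : probability Omega R)
    (n M : nat) (n_gt0 : (0 < n)%N) (G : 'I_M -> nat -> Omega -> 'I_n) (e A : R) :
  iid_uniform P G -> M%:R = (1 + e) * n%:R / 2 -> `|e| < 1 / 9 -> 1 <= A ->
  expR 1 / Num.sqrt n%:R < e ->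
  (dispersion_tail P n_gt0 G (A * e^-1 * expR (expR 100 * e ^+ 2 * n%:R))
    <= (expR (- A))%:E)%E.
Proof.
move=> iidG ME e19 A1 elt.
have nR : 0 < n%:R :> R by rewrite ltr0n.
have sn : 0 < Num.sqrt n%:R :> R by rewrite sqrtr_gt0.
have e0 : 0 < e by apply: lt_trans elt; rewrite divr_gt0 ?expR_gt0.
rewrite gtr0_norm// in e19 *.
have asn : expR 1 < e * Num.sqrt n%:R by rewrite -ltr_pdivrMr.
rewrite -(mulrA (expR 100)); set w := e ^+ 2 * n%:R.
have w1 : 1 <= w.
  have -> : w = (e * Num.sqrt n%:R) ^+ 2 by rewrite exprMn sqr_sqrtr// ltW.
  by rewrite expr_ge1//; have := expR_ge1Dx (1 : R); lra.
have ei1 : 9 <= e^-1 by rewrite -[leRHS]mul1r ler_pdivlMr//; lra.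
have [|t /andP[tl tu]] := @nat_between R e^-1; first by lra.
pose m := (1 + e) / 2.
have m01 : 0 <= m <= 1 by rewrite /m; lra.
have ty : logistic m t <= 2 * e.
  apply: le_trans (logistic_le t m01) _.
  rewrite (_ : 2 * m - 1 = e); last by rewrite /m; field.
  rewrite (max_l (ltW e0)) (_ : 2 * e = e + e); last by ring.
  rewrite lerD2l.
  rewrite -[leRHS]invrK lef_pV2 ?posrE ?invr_gt0 ?ltr0n//.
  by apply: le_trans tl _; rewrite ler_nat -addn2 leq_addr.
have /andP[y0 _] := logistic_itv t m01.
apply: (@dispersion_tail_le _ _ _ _ _ _ t _ _ m A (4 * w)) => //.
- by rewrite ME /m; field.
- by rewrite /m; lra.
- by lra.
- apply: (@le_trans _ _ (n%:R * (2 * e) ^+ 2)).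
    by rewrite ler_wpM2l ?(ltW nR)// lerXn2r ?nnegrE// ?mulr_ge0// ltW.
  by rewrite /w le_eqVlt; apply/orP; left; apply/eqP; ring.
rewrite -[leRHS]mulrA ler_wpM2l//; first by lra.
have C8 : 8 * expR (5 * (4 * w)) <= expR (expR 100 * w).
  apply: (@le_trans _ _ (expR (10 * w + 5 * (4 * w)))).
    rewrite expRD ler_wpM2r ?expR_ge0//.
    by apply: le_trans (expR_ge1Dx _); lra.
  rewrite ler_expR; have : 101 <= expR 100 :> R by have := expR_ge1Dx (100 : R); lra.
  by move=> C101; rewrite (_ : _ + _ = 30 * w); [rewrite ler_wpM2r; lra|ring].
apply: (@le_trans _ _ (e^-1 * (8 * expR (5 * (4 * w))))); last first.
  by rewrite ler_wpM2l// invr_ge0 ltW.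
rewrite !mulrA [e^-1 * 8]mulrC ler_wpM2r ?expR_ge0//.
by lra.
Qed.

Theorem theorem1p1 (R : realType) :
  exists C : R, 0 < C /\
  forall eps : nat -> R,
    eps n @[n --> \oo] --> 0 ->
    (forall n : nat, (1 <= n)%N -> `|eps n| < 1 / 9) ->
  exists n0 : nat,
  forall (n M : nat) (n_gt0 : (0 < n)%N),
    (n0 <= n)%N ->
    M%:R = (1 + eps n) * n%:R / 2 ->
  forall (d : measure_display) (Omega : measurableType d)
    (P : probability Omega R) (G : 'I_M -> nat -> Omega -> 'I_n),
    iid_uniform P G ->
  forall A : R, 1 <= A ->
  [/\ eps n < - (expR 1 / Num.sqrt n%:R) ->
        (dispersion_tail P n_gt0 G
           (A * C * `|eps n|^-1 * ln (eps n ^+ 2 * n%:R))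
         <= (expR (- A))%:E)%E,
      `|eps n| <= expR 1 / Num.sqrt n%:R ->
        (dispersion_tail P n_gt0 G (A * C * Num.sqrt n%:R)
         <= (expR (- A))%:E)%E
    & expR 1 / Num.sqrt n%:R < eps n ->
        (dispersion_tail P n_gt0 G
           (A * (eps n)^-1 * expR (C * eps n ^+ 2 * n%:R))
         <= (expR (- A))%:E)%E].
Proof.
(* Far from optimal; the critical regime asks for at least 8 e^80. *)
exists (expR 100); split; first exact: expR_gt0.
move=> eps _ eps19; exists 100%N => n M n_gt0 n100 ME d Omega P G iidG A A1.
have e19 := eps19 n n_gt0.
split.
- exact: subcritical_tail.
- exact: critical_tail.
- exact: supercritical_tail.
Qed.
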